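(* For any $n>1$ and any $(a_1,\dots,a_n)\in\Sigma$, $\chi(a_1,\dots,a_n)\le\left\lfloor\frac{3}{2}n\right\rfloor+1$.
   Context: $\Sigma$ is the set of strictly increasing sequences $a_1<\dots<a_n$ of positive integers with $\gcd(a_1,\dots,a_n)=1$. For $S=\{\pm a_1,\dots,\pm a_n\}$, the Schreier graph $G_S$ has vertex set $F(2^\mathbb{Z})=\{x\in2^\mathbb{Z}: s\cdot x\ne x\ \forall s\ne0\}$ with $(s\cdot x)(m)=x(m+s)$, and $x,y$ adjacent iff $s\cdot x=y$ for some $s\in S$. $\chi(a_1,\dots,a_n)$ is the Borel chromatic number of $G_S$ (least size of a finite discrete set $K$ admitting a Borel proper coloring $F(2^\mathbb{Z})\to K$). *)

(* Defs.v *)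
From mathcomp Require Import all_boot all_order all_algebra.
From mathcomp Require Import all_classical all_reals all_analysis.

Set Implicit Arguments.
Unset Strict Implicit.
Unset Printing Implicit Defensive.

Import Order.TTheory GRing.Theory Num.Theory.
Local Open Scope classical_set_scope.
Local Open Scope ring_scope.

(* The graph has vertex set V and adjacency relation E restricted to V.
   Colorings are total functions on T whose values outside V are irrelevant.
   Borel subsets of V are the traces on V of Borel subsets of T, and every
   subset of the discrete space K is Borel. *)
Definition borel_proper_coloring (T : topologicalType) (V : set T)
    (E : T -> T -> Prop) (K : finType) (c : T -> K) : Prop :=
  (forall A : set K, strace <<s open >> V (c @^-1` A `&` V)) /\
  (forall x y, V x -> V y -> E x y -> c x <> c y).

Definition borel_colorable (T : topologicalType) (V : set T)
    (E : T -> T -> Prop) (k : nat) : Prop :=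
  exists K : finType, #|K| = k /\
    exists c : T -> K, borel_proper_coloring V E c.

(* A relation rather than a function, since a least k exists only when some
   finite Borel coloring does. *)
Definition is_borel_chromatic_number (T : topologicalType) (V : set T)
    (E : T -> T -> Prop) (k : nat) : Prop :=
  borel_colorable V E k /\ forall j, borel_colorable V E j -> (k <= j)%N.

(* 2^Z with the product topology of discrete bool. *)
Definition bool_shift_space : topologicalType := {ptws int -> bool}.

Definition shift_act (s : int) (x : bool_shift_space) : bool_shift_space :=
  fun m => x (m + s).

Definition free_part : set bool_shift_space :=
  [set x | forall s : int, s != 0 -> shift_act s x <> x].

Definition Sigma : set (seq nat) :=
  [set a | [/\ sorted ltn a, {in a, forall i, (0 < i)%N} &
               \big[gcdn/0%N]_(i <- a) i = 1%N]].

Definition sym_set (a : seq nat) : set int :=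
  [set s | exists2 i : nat, i \in a & s = i%:Z \/ s = - i%:Z].

Definition schreier_adj (a : seq nat) (x y : bool_shift_space) : Prop :=
  exists2 s : int, sym_set a s & shift_act s x = y.

Definition is_chi (a : seq nat) (k : nat) : Prop :=
  is_borel_chromatic_number free_part (schreier_adj a) k.

(* Main.v *)
(* In fact n + 2 colors suffice, and n + 2 <= 3n/2 + 1 when n >= 2.
   On the half-line nat, let d be the greedy coloring: d r is the least color
   not occurring at a point r - i with i in S. It uses the colors 0..n, and a
   point with d r = j sees all the colors i < j among its n left neighbors.
   Any coloring of the points to the left of 0 by 0..n can be continued to the
   right so as to become a fixed renaming of d, using one extra color: for
   k = 0, 1, ..., n in turn, the points with d r = k get the color n + 1 - k, and
   those with d r > k the least color not seen on the left. The latter already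
   see k + 1 distinct colors >= n + 1 - k, so after a while they only use colors
   < n - k, which frees the color n - k needed at the next stage.
   A Borel set of markers with long bounded gaps cuts each free orbit into
   intervals; on each of them one restarts d, interpolating from the coloring of
   the previous interval. The color of a point depends on finitely many marker
   positions, hence is Borel. *)
Require Import Defs.
From mathcomp Require Import all_boot all_order all_algebra.
From mathcomp Require Import all_classical all_reals all_analysis.
From mathcomp Require Import zify.

Set Implicit Arguments.
Unset Strict Implicit.
Unset Printing Implicit Defensive.
Import Order.TTheory GRing.Theory Num.Theory.
Local Open Scope classical_set_scope.

(** * Greedy coloring and interpolation on the half-line *)

Lemma mex_subproof (s : seq nat) : exists m, m \notin s.
Proof.
exists (\max_(i <- s) i).+1; apply/negP => /(@leq_bigmax_seq _ s xpredT id).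
by move=> /(_ isT); rewrite ltnn.
Qed.

Definition mex (s : seq nat) : nat := ex_minn (mex_subproof s).

Lemma mexP (s : seq nat) : mex s \notin s.
Proof. by rewrite /mex; case: ex_minnP. Qed.

Lemma lt_mex (s : seq nat) j : j < mex s -> j \in s.
Proof.
rewrite /mex; case: ex_minnP => m _ minm ltjm.
by apply/negPn/negP => /minm; rewrite leqNgt ltjm.
Qed.

Lemma mex_leq_size (s : seq nat) : mex s <= size s.
Proof.
rewrite -[X in X <= _](size_iota 0); apply: uniq_leq_size (iota_uniq _ _) _.
by move=> j; rewrite mem_iota => /lt_mex.
Qed.

(* The listed elements of s all exceed n - t, and there are t of them. *)
Lemma mex_leq_sub (n t : nat) (s : seq nat) :
  size s <= n -> t <= n -> (forall i, i < t -> n.+1 - i \in s) ->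
  mex s <= n - t.
Proof.
move=> sn tn tops; rewrite leqNgt; apply/negP => ltmex.
suff : n < size s by rewrite ltnNge sn.
pose l := iota 0 (n - t).+1 ++ iota (n.+2 - t) t.
have -> : n.+1 = size l by rewrite size_cat !size_iota; lia.
apply: uniq_leq_size.
  rewrite cat_uniq !iota_uniq /= andbT; apply/hasPn => j.
  rewrite mem_iota => jt; change (j \notin iota 0 (n - t).+1).
  by rewrite mem_iota; lia.
move=> j; rewrite mem_cat !mem_iota => /orP[] jl.
  by apply: lt_mex; lia.
by have -> : j = n.+1 - (n.+1 - j) by [lia]; apply: tops; lia.
Qed.

(** [run t] tabulates the values below [t] and keeps the default [x0] elsewhere; locality of [rule]
    makes these defaults harmless. *)
Lemma course_of_values_recursion (T : Type) (rule : nat -> (nat -> T) -> T) :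
  T ->
  (forall t f g, (forall u, u < t -> f u = g u) -> rule t f = rule t g) ->
  exists f : nat -> T, forall t, f t = rule t f.
Proof.
move=> x0 rule_local.
pose run := fix run t := if t is t'.+1 then
  (fun u => if u == t' then rule t' (run t') else run t' u) else (fun=> x0).
have runE t u : u < t -> run t u = run u.+1 u.
  elim: t => // t IH; rewrite ltnS leq_eqVlt => /predU1P[->//|ut].
  by rewrite /= (ltn_eqF ut) (IH ut) /= eqxx.
exists (fun t => run t.+1 t) => t; rewrite /= eqxx.
by apply: rule_local => u /runE ->.
Qed.

Lemma greedy_coloring_exists (S : seq nat) :
  {in S, forall i, 0 < i} ->
  exists d : nat -> nat,
    [/\ forall r, d r <= size S,
        forall r i, i \in S -> i <= r -> d r != d (r - i) &
        forall r j, j < d r -> exists2 i, i \in S & i <= r /\ d (r - i) = j].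
Proof.
move=> S_gt0.
pose back r (f : nat -> nat) := [seq f (r - i) | i <- S & i <= r].
have [r f g fg|d dE] := @course_of_values_recursion _ (fun r f => mex (back r f)) 0.
  congr mex; apply/eq_in_map => i; rewrite mem_filter => /andP[ir iS].
  by apply: fg; have := S_gt0 _ iS; lia.
exists d; split=> [r|r i iS ir|r j].
- rewrite dE (leq_trans (mex_leq_size _)) // size_map size_filter.
  exact: count_size.
- rewrite (dE r); apply: contraNneq (mexP (back r d)) => ->.
  by apply: map_f; rewrite mem_filter ir.
rewrite (dE r) => /lt_mex/mapP[i]; rewrite mem_filter => /andP[ir iS] ->.
by exists i.
Qed.

(* w h colors the interval after a marker whose preceding gap is h; e is the
   coloring on which all the intervals end. *)
Lemma interpolating_words_exist (S : seq nat) (L : nat) :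
  {in S, forall i, 0 < i <= L} -> 0 < L ->
  exists (N : nat) (e : nat -> nat) (w : nat -> nat -> nat),
   0 < N /\ forall h, N <= h ->
    [/\ forall r, w h r <= (size S).+1,
        forall r i, i \in S -> i <= r -> w h r != w h (r - i),
        forall r i, i \in S -> r < i -> w h r != e (h + r - i),
        forall i, i \in S -> i <= h &
        forall r i, i \in S -> N - i <= r -> w h r = e r].
Proof.
move=> SL L_gt0; set n := size S.
have [|d [d_le d_proper d_greedy]] := @greedy_coloring_exists S.
  by move=> i /SL/andP[].
rewrite -/n in d_le.
(* Class 0 would be renamed [n.+1], the extra color; it takes 0 instead, which no class [j] with
   [1 <= j <= n] occupies. *)
pose e r := if d r == 0 then 0 else n.+1 - d r.
pose back t (f : nat -> nat) := [seq f (t - i) | i <- S].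
(* Positions after the marker are cut into blocks of length [L], and stage [k] consists of blocks
   [2k] and [2k + 1]. No neighbor is farther than [L], so a point of the second block sees to its
   right of the marker only points of stage [k] on its left. *)
pose rule h t (f : nat -> nat) := if t < h then e t else
  let r := t - h in let q := r %/ L in
  if n < q./2 then e r else
  if d r <= q./2 then n.+1 - d r else mex (back t f).
(* The stages 0..n fill [2 * n + 2] blocks; one more block leaves room for the [N - i] in the last
   clause. *)
pose N := (2 * n + 3) * L.
have wE h : exists f : nat -> nat, N <= h -> forall t, f t = rule h t f.
  (* The bound [N <= h] keeps [t] positive, so that [t - i] is earlier than [t]; smaller gaps get a
     dummy word. *)
  have [Nh|] := boolP (N <= h); last by exists (fun=> 0).
  have [t f g fg|f fE] := @course_of_values_recursion _ (rule h) 0.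
    rewrite /rule; case: ltnP => // ht; case: ifP => // _; case: ifP => // _.
    congr mex; apply/eq_in_map => i /SL/andP[i0 iL]; apply: fg.
    by rewrite /N in Nh; nia.
  by exists f.
have [f fE] := boolp.choice wE.
exists N, e, (fun h r => f h (h + r)); split; first by rewrite /N; lia.
move=> h Nh /=; have {wE} := fE _ Nh; move: (f h) => {fE}f fE.
have LN : L <= N by rewrite /N; nia.
have f_past t : t < h -> f t = e t by move=> th; rewrite fE /rule th.
have f_new r : f (h + r) = let q := r %/ L in
  if n < q./2 then e r else
  if d r <= q./2 then n.+1 - d r else mex [seq f (h + r - i) | i <- S].
  by rewrite fE /rule ltnNge leq_addr /= addKn.
have q_back r i : i \in S -> i <= r -> (r %/ L).-1 <= (r - i) %/ L <= r %/ L.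
  move=> /SL/andP[i0 iL] ir; rewrite leq_div2r ?leq_subr // andbT.
  have := leq_div2r L (leq_sub2l r iL).
  suff -> : (r - L) %/ L = (r %/ L).-1 by [].
  by have := divnBMl 1 r L; rewrite mul1n subn1.
have small_q r i : i \in S -> r < i -> r %/ L = 0.
  by move=> /SL/andP[_ iL] ri; rewrite divn_small // (leq_trans ri).
have named r : d r <= (r %/ L)./2 -> (r %/ L)./2 <= n -> f (h + r) = n.+1 - d r.
  by move=> dq qn; rewrite f_new /= ltnNge qn /= dq.
(* Greediness of [d] gives a left neighbor in each class [j < uphalf q], where [q] is the block of
   [r]. It lies at most one block back, where class [j] already has its name [n.+1 - j]. *)
have mex_bound r : (r %/ L)./2 < d r ->
    mex [seq f (h + r - i) | i <- S] <= n - uphalf (r %/ L).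
  move=> qd; have dn := d_le r.
  apply: mex_leq_sub; rewrite ?size_map //; first by lia.
  move=> j jq; have [|i iS [ir dj]] := d_greedy r j; first by lia.
  have := q_back _ _ iS ir => qb; apply/mapP; exists i => //.
  by rewrite -addnBA // named ?dj //; lia.
have unnamed r : (r %/ L)./2 < d r -> f (h + r) <= n - uphalf (r %/ L).
  move=> qd; have dn := d_le r; rewrite f_new /=.
  rewrite ltnNge (_ : (r %/ L)./2 <= n) /=; last by lia.
  by rewrite (leqNgt (d r)) qd /= mex_bound.
have mexed r i : i \in S -> (r %/ L)./2 < d r -> f (h + r) != f (h + r - i).
  move=> iS qd; have dn := d_le r; rewrite f_new /=.
  rewrite ltnNge (_ : (r %/ L)./2 <= n) /=; last by lia.
  rewrite (leqNgt (d r)) qd /=; apply: contraNneq (mexP [seq f (h + r - i) | i <- S]) => ->.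
  exact: map_f.
have e_le r : e r <= n by rewrite /e; case: eqP; lia.
have final r : n < (r %/ L)./2 -> f (h + r) = e r by rewrite f_new /= => ->.
split=> [r|r i iS ir|r i iS ri|i iS|r i iS Nr].
- rewrite f_new /=; case: ifP => _; first by rewrite (leq_trans (e_le r)).
  case: (leqP (d r)) => [_|qd]; first exact: leq_subr.
  exact: leq_trans (mex_bound _ qd) (leq_trans (leq_subr _ _) (leqnSn _)).
- rewrite addnBA //; have [dq|] := leqP (d r) (r %/ L)./2; last exact: mexed.
  have qb := q_back _ _ iS ir; have dd := d_proper _ _ iS ir.
  have dn := d_le r; have dn' := d_le (r - i).
  rewrite -addnBA //.
  (* An unnamed neighbor in block [q'] has color at most [n - uphalf q']. As [q' >= q - 1], also
     [d r <= q./2 <= uphalf q'], so the name [n.+1 - d r] is larger. Past the last stage every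
     neighbor is named. *)
  have [q'd|dq'] := ltnP ((r - i) %/ L)./2 (d (r - i)).
    have := unnamed _ q'd.
    have [qn|qn] := leqP (r %/ L)./2 n; first by rewrite (named r) //; lia.
    by lia.
  have [qn|qn] := leqP (r %/ L)./2 n.
    by rewrite !named //; lia.
  rewrite (final r) //.
  have [q'n|q'n] := leqP ((r - i) %/ L)./2 n; first by rewrite named // /e; case: (d r =P 0); lia.
  by rewrite final // /e; case: (d r =P 0); case: (d _ =P 0); lia.
- have [] := leqP (d r) (r %/ L)./2; last first.
    move=> /(mexed _ _ iS); rewrite (f_past (h + r - i)) //; lia.
  (* In block 0 only class 0 is named, by the color [n.+1] that [e] never takes. *)
  rewrite (small_q _ _ iS ri) => dq; rewrite named ?(small_q _ _ iS ri) //.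
  by have := e_le (h + r - i); lia.
- by have /andP[_ iL] := SL _ iS; lia.
rewrite final //; suff : 2 * n + 2 <= r %/ L by lia.
have /andP[_ iL] := SL _ iS.
by rewrite leq_divRL //; rewrite /N in Nr; lia.
Qed.

(** * Borel sets of the shift space *)

(** Splitting on the last bit writes the set as a finite Boolean combination of the given ones. *)
Lemma preimage_code_measurable (d : measure_display) (T : measurableType d)
    (b : nat -> T -> bool) (M : nat) (P : set (seq bool)) :
  (forall j, measurable [set x | b j x]) ->
  measurable [set x | P (mkseq (b^~ x) M)].
Proof.
move=> mb; elim: M P => [|M IH] P.
  rewrite [X in measurable X](_ : _ = [set _ | P [::]]); last by apply/seteqP; split.
  have [P0|nP0] := pselect (P [::]).
    by rewrite [X in measurable X](_ : _ = setT) //; apply/seteqP; split.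
  by rewrite [X in measurable X](_ : _ = set0) //; apply/seteqP; split.
rewrite [X in measurable X](_ : _ =
    ([set x | P (rcons (mkseq (b^~ x) M) true)] `&` [set x | b M x]) `|`
    ([set x | P (rcons (mkseq (b^~ x) M) false)] `\` [set x | b M x])).
  apply: measurableU; [apply: measurableI|apply: measurableD] => //.
  - exact: (IH [set s | P (rcons s true)]).
  - exact: (IH [set s | P (rcons s false)]).
apply/seteqP; split => x /=; rewrite mkseqS.
  by case: (b M x) => ?; [left|right].
by case: (b M x) => -[[]|[]].
Qed.

Definition borel_shift_space := g_sigma_algebraType (@open bool_shift_space).

Lemma cylinder_measurable (m : int) :
  @measurable _ borel_shift_space [set x : bool_shift_space | x m].
Proof.
apply: sub_sigma_algebra.
have /continuousP : continuous ((fun x => x m) : bool_shift_space -> bool).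
  exact: (@proj_continuous int (fun=> bool) m).
move=> /(_ [set true]); apply; exact: discrete_open.
Qed.

Lemma shift_actD (s t : int) (x : bool_shift_space) :
  shift_act s (shift_act t x) = shift_act (s + t)%R x.
Proof. by apply/funext => m; rewrite /shift_act addrA. Qed.

Lemma shift_act0 (x : bool_shift_space) : shift_act 0%R x = x.
Proof. by apply/funext => m; rewrite /shift_act addr0. Qed.

(* Quantifying over s makes the class invariant under the action without having
   to prove that the action is continuous. *)
Definition shift_borel (b : bool_shift_space -> bool) : Prop :=
  forall s : int, @measurable _ borel_shift_space [set x | b (shift_act s x)].

Lemma shift_borel_act (b : bool_shift_space -> bool) (t : int) :
  shift_borel b -> shift_borel (b \o shift_act t).
Proof.
move=> mb s; rewrite /= [X in measurable X](_ : _ = [set x | b (shift_act (t + s)%R x)]) //.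
by apply/seteqP; split => x /=; rewrite shift_actD.
Qed.

Lemma shift_borel_cst (c : bool) : shift_borel (fun=> c).
Proof.
case: c => s.
  rewrite [X in measurable X](_ : _ = setT); last by apply/seteqP; split.
  exact: (@measurableT _ borel_shift_space).
rewrite [X in measurable X](_ : _ = set0); last by apply/seteqP; split.
exact: (@measurable0 _ borel_shift_space).
Qed.

Lemma shift_borelN (b : bool_shift_space -> bool) :
  shift_borel b -> shift_borel (fun x => ~~ b x).
Proof.
move=> mb s; rewrite [X in measurable X](_ : _ = ~` [set x | b (shift_act s x)]).
  exact: (@measurableC _ borel_shift_space).
by apply/seteqP; split => x /= /negP.
Qed.

Lemma shift_borelI (b c : bool_shift_space -> bool) :
  shift_borel b -> shift_borel c -> shift_borel (fun x => b x && c x).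
Proof.
move=> mb mc s; rewrite [X in measurable X](_ : _ =
  [set x | b (shift_act s x)] `&` [set x | c (shift_act s x)]).
  exact: (@measurableI _ borel_shift_space).
by apply/seteqP; split => x /= /andP.
Qed.

Lemma shift_borelU (b c : bool_shift_space -> bool) :
  shift_borel b -> shift_borel c -> shift_borel (fun x => b x || c x).
Proof.
move=> mb mc s; rewrite [X in measurable X](_ : _ =
  [set x | b (shift_act s x)] `|` [set x | c (shift_act s x)]).
  exact: (@measurableU _ borel_shift_space).
by apply/seteqP; split => x /= /orP.
Qed.

Lemma shift_borel_all (b : nat -> bool_shift_space -> bool) (r : seq nat) :
  (forall j, shift_borel (b j)) -> shift_borel (fun x => all (b^~ x) r).
Proof.
move=> mb; elim: r => [|j r IH] /=; first exact: shift_borel_cst.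
exact: shift_borelI.
Qed.

Lemma shift_borel_exists (b : nat -> bool_shift_space -> bool) :
  (forall j, shift_borel (b j)) -> shift_borel (fun x => `[< exists j, b j x >]).
Proof.
move=> mb s; rewrite [X in measurable X](_ : _ =
  \bigcup_j [set x | b j (shift_act s x)]).
  apply: (@bigcup_measurable _ borel_shift_space) => j _; exact: mb.
apply/seteqP; split => x /=.
  by move=> /asboolP[j bj]; exists j.
by move=> [j _ bj]; apply/asboolP; exists j.
Qed.

Definition window (m : nat) (x : bool_shift_space) : seq bool :=
  mkseq (fun i => x (i%:Z - m%:Z)%R) (2 * m).+1.

Lemma shift_borel_window (m : nat) (w : seq bool) :
  shift_borel (fun x => window m x == w).
Proof.
move=> s; rewrite [X in measurable X](_ : _ = [set x | [set v | v == w]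
  (mkseq (fun i => x (i%:Z - m%:Z + s)%R) (2 * m).+1)]) //.
apply: (@preimage_code_measurable _ borel_shift_space
  (fun i x => x (i%:Z - m%:Z + s)%R)) => j.
exact: cylinder_measurable.
Qed.

(** * Separated sets and Borel markers *)

Definition shift_isolated (N : nat) (b : bool_shift_space -> bool)
    (x : bool_shift_space) : bool :=
  all (fun s : nat => ~~ b (shift_act s%:Z%R x) && ~~ b (shift_act (- s%:Z)%R x))
    (iota 1 N.-1).

Lemma shift_borel_isolated (N : nat) (b : bool_shift_space -> bool) :
  shift_borel b -> shift_borel (shift_isolated N b).
Proof.
move=> mb; apply: shift_borel_all => s.
by apply: shift_borelI; apply: shift_borelN; apply: shift_borel_act.
Qed.

Lemma shift_isolatedP (N : nat) (b : bool_shift_space -> bool) x :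
  reflect (forall s : int, s != 0%R -> (`|s| < N)%N -> ~~ b (shift_act s x))
    (shift_isolated N b x).
Proof.
apply: (iffP allP) => [bx s s0 sN|bx s].
  have : `|s|%N \in iota 1 N.-1 by rewrite mem_iota; lia.
  move=> /bx/andP[bs bNs].
  by have [<-|<-] : `|s|%N%:Z%R = s \/ (- `|s|%N%:Z)%R = s by lia.
by rewrite mem_iota => s1N; rewrite !bx //; lia.
Qed.

Definition shift_separated (N : nat) (b : bool_shift_space -> bool) : Prop :=
  forall x, b x -> shift_isolated N b x.

(* Pieces indexed by finite patterns w: points seeing w whose near translates
   do not; they are separated by construction and cover the free part. *)
Definition window_piece (N k : nat) (x : bool_shift_space) : bool :=
  if unpickle k is Some (m, w) then
    (window m x == w) && shift_isolated N (fun y => window m y == w) x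
  else false.

Lemma window_piece_borel (N k : nat) : shift_borel (window_piece N k).
Proof.
rewrite /window_piece; case: unpickle => [[m w]|]; last exact: shift_borel_cst.
by apply: shift_borelI; [|apply: shift_borel_isolated]; apply: shift_borel_window.
Qed.

Lemma window_piece_separated (N k : nat) : shift_separated N (window_piece N k).
Proof.
move=> x; rewrite /window_piece; case: unpickle => [[m w]|] // /andP[_].
move=> /shift_isolatedP xw; apply/shift_isolatedP => s s0 sN.
by rewrite (negPf (xw s s0 sN)).
Qed.

(** A free point differs from each nontrivial translate at some coordinate; one window wide enough
    for the finitely many near translates tells them all apart from the point. *)
Lemma window_piece_cover (N : nat) (x : bool_shift_space) :
  free_part x -> exists k, window_piece N k x.
Proof.
move=> fx.
have window_neq (s : int) : exists m : nat, s != 0%R ->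
    forall m', (m <= m')%N -> window m' (shift_act s x) != window m' x.
  have [->|s0] := eqVneq s 0%R; first by exists 0%N.
  have /eqP := fx s s0; move=> /eqP ne.
  have [p px] : exists p, shift_act s x p <> x p.
    apply: contrapT => /forallNP eqx; apply: ne; apply/funext => p.
    exact: contrapT (eqx p).
  exists `|p|%N => _ m mp; apply: contra_notN px => /eqP ww.
  have := congr1 (fun v => nth false v `|(p + m%:Z)%R|%N) ww.
  rewrite /window !nth_mkseq; [|lia..].
  by have -> : (`|(p + m%:Z)%R|%N%:Z - m%:Z)%R = p by lia.
have [f fP] := choice window_neq.
(* The sum dominates [f s] for every [s] with [|s| < N]. *)
pose m := (\sum_(i < N) (f i%:Z%R + f (- i%:Z)%R))%N.
have fm (s : int) : (`|s| < N)%N -> (f s <= m)%N.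
  move=> sN; rewrite /m (bigD1 (Ordinal sN)) //=.
  have [->|->] : `|s|%N%:Z%R = s \/ `|s|%N%:Z%R = (- s)%R by lia.
    by lia.
  by rewrite opprK; lia.
exists (pickle (m, window m x)); rewrite /window_piece pickleK eqxx /=.
by apply/shift_isolatedP => s s0 sN; apply: fP (fm _ sN).
Qed.

(** Greedy construction of a maximal separated set, reached as the union over all [k]. *)
Fixpoint marker (N k : nat) (x : bool_shift_space) : bool :=
  if k is k'.+1 then
    marker N k' x || (window_piece N k' x && shift_isolated N (marker N k') x)
  else false.

Lemma marker_borel (N k : nat) : shift_borel (marker N k).
Proof.
elim: k => [|k IH]; first exact: shift_borel_cst.
apply: shift_borelU => //; apply: shift_borelI; first exact: window_piece_borel.
exact: shift_borel_isolated.
Qed.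

(** Two points added together lie in one separated piece, and a new point is isolated from the old
    ones; the shift by [- s] exchanges the two points. *)
Lemma marker_separated (N k : nat) : shift_separated N (marker N k).
Proof.
elim: k => // k IH x xk; apply/shift_isolatedP => s s0 sN.
have xE : x = shift_act (- s)%R (shift_act s x).
  by rewrite shift_actD addNr shift_act0.
have Ns0 : (- s)%R != 0%R by rewrite oppr_eq0.
have NsN : (`|(- s)%R| < N)%N by rewrite abszN.
move: xk => /= /orP[xk|/andP[xp /shift_isolatedP xi]]; apply/negP.
  move=> /orP[|/andP[_ /shift_isolatedP/(_ _ Ns0 NsN)]]; last by rewrite -xE xk.
  by apply/negP; move: (IH _ xk) => /shift_isolatedP; apply.
move=> /orP[|/andP[sp _]]; first by apply/negP; apply: xi.
by have /shift_isolatedP/(_ _ s0 sN) := window_piece_separated xp; rewrite sp.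
Qed.

Lemma marker_leq (N k l : nat) x : (k <= l)%N -> marker N k x -> marker N l x.
Proof.
move=> /subnKC <-; elim: (l - k)%N => [|j IH]; first by rewrite addn0.
by rewrite addnS => /IH /= ->.
Qed.

Lemma borel_markers_exist (N : nat) :
  exists b : bool_shift_space -> bool,
    [/\ shift_borel b, shift_separated N b &
        forall x, free_part x -> exists2 s : int, (`|s| <= N)%N & b (shift_act s x)].
Proof.
exists (fun x => `[< exists k, marker N k x >]); split.
- by apply: shift_borel_exists; exact: marker_borel.
- move=> x /asboolP[k xk]; apply/shift_isolatedP => s s0 sN; apply/negP => /asboolP[l xl].
  have := marker_leq (leq_maxl k l) xk => /marker_separated/shift_isolatedP/(_ s s0 sN).
  by rewrite (marker_leq (leq_maxr k l) xl).
move=> x /(window_piece_cover N)[k xk].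
(* Maximality: a point of piece [k] becomes a marker unless an earlier marker at distance less than
   [N] blocks it. *)
have [xi|] := boolP (shift_isolated N (marker N k) x).
  exists 0%R => //; rewrite shift_act0; apply/asboolP.
  by exists k.+1; rewrite /= xk xi orbT.
move=> /allPn[s]; rewrite mem_iota negb_and !negbK => sN /orP[] ms.
  by exists s%:Z%R; [lia|apply/asboolP; exists k].
by exists (- s%:Z)%R; [lia|apply/asboolP; exists k].
Qed.

(** * Gaps between consecutive markers *)

(* s j tells whether there is a marker j steps back; the code is the gap between
   the last two markers followed by the distance to the last one. *)
Definition gap_code (s : seq bool) : nat * nat :=
  let r := index true s in ((index true (drop r.+1 s)).+1, r).

Lemma index_mkseq (b : nat -> bool) (M r : nat) :
  r < M -> b r -> (forall j, j < r -> ~~ b j) -> index true (mkseq b M) = r.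
Proof.
move=> rM br rmin; apply/eqP; rewrite eqn_leq; apply/andP; split.
  by rewrite leqNgt; apply/negP => /(before_find false); rewrite nth_mkseq //= br.
have ex : true \in mkseq b M.
  by apply/mapP; exists r; rewrite ?mem_iota ?br.
have iM : index true (mkseq b M) < M by rewrite -[X in _ < X](size_mkseq b) index_mem.
have := nth_index false ex; rewrite nth_mkseq // => bi.
by rewrite leqNgt; apply/negP => /rmin; rewrite bi.
Qed.

Lemma gap_code_mkseq (b : nat -> bool) (M r h : nat) :
  0 < h -> r + h < M -> b r -> b (r + h) ->
  (forall j, j < r + h -> b j -> j = r) -> gap_code (mkseq b M) = (h, r).
Proof.
move=> h0 rhM br brh uniq_r; rewrite /gap_code (@index_mkseq b M r) //; last 2 first.
- by lia.
- by move=> j jr; apply/negP => /uniq_r; lia.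
congr (_, _); rewrite /mkseq -map_drop drop_iota add0n -[X in iota X]addn0 iotaDl -map_comp.
rewrite (@index_mkseq _ _ h.-1) /=; [lia|lia| |].
- by have -> : r.+1 + h.-1 = r + h by lia.
by move=> j jh; apply/negP => /uniq_r; lia.
Qed.

Lemma syndetic_gap (b : nat -> bool) (B : nat) :
  (forall i, exists2 j, i <= j < i + B & b j) ->
  exists h r, [/\ 0 < h, r < B, h <= B, b r & b (r + h)] /\
    forall j, j < r + h -> b j -> j = r.
Proof.
move=> synd.
have next i : exists j, [/\ i <= j < i + B, b j & forall k, i <= k < j -> ~~ b k].
  have ex : exists j, (i <= j) && b j.
    by have [j ij bj] := synd i; exists j; lia.
  have [j0 ij0 bj0] := synd i.
  exists (ex_minn ex); case: ex_minnP => j /andP[ij bj] jmin; split=> //.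
    by have := jmin j0; lia.
  by move=> k ikj; apply/negP => bk; have := jmin k; lia.
have [r [rB br rmin]] := next 0.
have [r' [r'B br' r'min]] := next r.+1.
exists (r' - r), r; split; first by rewrite subnKC; [split=> //; lia|lia].
move=> j jr' bj; have [jr|jr|//] := ltngtP j r.
  by have := rmin j; rewrite bj; lia.
by have := r'min j; rewrite bj; lia.
Qed.

(** * Borel coloring of the free part with [n + 2] colors *)

Theorem theorem5p5 (n : nat) (a : n.-tuple nat) (hn : (1 < n)%N)
    (ha : Sigma a) :
  exists k : nat, is_chi a k /\ (k <= (3 * n) %/ 2 + 1)%N.
Proof.
suff colorable : borel_colorable free_part (schreier_adj a) n.+2.
  have ex : exists k, `[< borel_colorable free_part (schreier_adj a) k >].
    by exists n.+2; apply/asboolP.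
  exists (ex_minn ex); case: ex_minnP => k /asboolP kcol kmin; split.
    by split=> // j jcol; apply: kmin; apply/asboolP.
  have := kmin n.+2 (asboolT colorable).
  by have := leq_div2r 2 (_ : n.+1 * 2 <= 3 * n); rewrite mulnK //; lia.
have [_ a_gt0 _] := ha.
pose L := (\max_(i <- a) i).+1.
have aL : {in a, forall i, 0 < i <= L}.
  by move=> i ia; rewrite (a_gt0 i ia) ltnW // ltnS (@leq_bigmax_seq _ a xpredT id).
have [//|N [e [w [N0 wP]]]] := interpolating_words_exist aL.
have [b [b_borel b_sep b_synd]] := borel_markers_exist N.
pose back (x : bool_shift_space) (j : nat) := b (shift_act (- j%:Z)%R x).
(* A ball of radius [N] around the point [i + N] steps back meets the markers, and it covers the
   [2 * N + 1] steps from [i] on. The last two markers are then found among [2 * B] bits. *)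
pose B := (2 * N).+1.
pose c (x : bool_shift_space) : 'I_n.+2 :=
  let hr := gap_code (mkseq (back x) (2 * B)) in inord (w hr.1 hr.2).
have back_synd x : free_part x -> forall i, exists2 j, i <= j < i + B & back x j.
  move=> fx i.
  have [|s sN bs] := b_synd (shift_act (- (i + N)%N%:Z)%R x).
    move=> s s0 /(congr1 (shift_act (i + N)%N%:Z%R)) /eqP.
    rewrite !shift_actD addrN shift_act0 addrAC addrN add0r => /eqP.
    exact: fx.
  exists `|((i + N)%N%:Z - s)%R|%N; first by rewrite /B; lia.
  move: bs; rewrite /back shift_actD.
  by have -> : (s - (i + N)%N%:Z = - `|((i + N)%N%:Z - s)%R|%N%:Z)%R by lia.
have back_sep x i j : back x i -> back x j -> i < j -> i + N <= j.
  move=> bi bj ij; rewrite leqNgt; apply/negP => jiN.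
  have /shift_isolatedP/(_ (i%:Z - j%:Z)%R) := b_sep _ bi.
  rewrite shift_actD (_ : (i%:Z - j%:Z - i%:Z = - j%:Z)%R); last by lia.
  by rewrite -/(back x j) bj => H; have : false by apply: H; lia.
have cE x h r : 0 < h -> r < B -> h <= B -> back x r -> back x (r + h) ->
    (forall j, j < r + h -> back x j -> j = r) -> c x = inord (w h r).
  move=> h0 rB hB br brh uniq_r.
  by rewrite /c (gap_code_mkseq h0 _ br brh uniq_r) //; lia.
have c_proper x i : i \in (a : seq nat) -> free_part x ->
    free_part (shift_act i%:Z%R x) -> c x <> c (shift_act i%:Z%R x).
  move=> ia fx fy; set y := shift_act _ x in fy *.
  have back_y j : back y (j + i) = back x j.
    by rewrite /back /y shift_actD; congr (b (shift_act _ x)); lia.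
  have [h [r [[h0 rB hB br brh] uniq_r]]] := syndetic_gap (back_synd y fy).
  have [h' [r' [[h'0 r'B h'B br' br'h'] uniq_r']]] := syndetic_gap (back_synd x fx).
  have Nh : N <= h by have := back_sep _ _ _ br brh; lia.
  have Nh' : N <= h' by have := back_sep _ _ _ br' br'h'; lia.
  rewrite (cE y h r) // (cE x h' r') //.
  have [w_le w_in w_cross w_long _] := wP _ Nh.
  have [w_le' _ _ _ w_end'] := wP _ Nh'.
  rewrite size_tuple in w_le w_le'.
  move=> /(congr1 (@nat_of_ord _)); rewrite !inordK ?ltnS //; apply/eqP; rewrite eq_sym.
  have ih := w_long i ia.
  have r'E : forall k, back x k -> k < r' + h' -> k = r'.
    by move=> k bk /uniq_r'; apply.
  (* The point [y] is [i] steps to the right of [x]. If [i <= r], both follow the same last marker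
     and are colored by the same word. *)
  have [ir|ri] := leqP i r.
    have r'r : r' = r - i.
      have bri : back x (r - i) by rewrite -back_y subnK.
      have [|le] := ltnP (r - i) (r' + h'); first by move=> /(r'E _ bri).
      have := uniq_r (r' + i); rewrite back_y => /(_ _ br'); lia.
    have h'h : h' = h.
      have e1 : back x (r - i + h) by rewrite -back_y (_ : r - i + h + i = r + h) //; lia.
      have [lt|lt|//] := ltngtP h h'.
        by have := r'E _ e1; lia.
      by have := uniq_r (r' + h' + i); rewrite back_y => /(_ _ br'h'); lia.
    by rewrite h'h r'r w_in.
  (* Otherwise the last marker of [y] lies beyond [x], and [x] is in the preceding interval, of
     length [h >= N]. Its position there is at least [N - i], where its word agrees with [e]
     whatever [h'] is. *)
  have r'r : r' = r + h - i.
    have e1 : back x (r + h - i) by rewrite -back_y subnK //; lia.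
    have [|le] := ltnP (r + h - i) (r' + h'); first by move=> /(r'E _ e1).
    have := uniq_r (r' + i); rewrite back_y => /(_ _ br'); lia.
  rewrite r'r (w_end' _ i ia); first by rewrite (addnC r) w_cross.
  by have := back_sep _ _ _ br brh; lia.
exists 'I_n.+2; split; first exact: card_ord.
exists c; split.
  move=> A; exists (c @^-1` A) => //.
  apply: (@preimage_code_measurable _ borel_shift_space (fun j x => back x j) (2 * B)
    [set v | A (inord (w (gap_code v).1 (gap_code v).2))]) => j.
  exact: b_borel.
move=> x y fx fy [s [i ia [->|->]]] xy.
  by rewrite -xy; apply: c_proper; rewrite ?xy.
have yx : shift_act i%:Z%R y = x by rewrite -xy shift_actD addrN shift_act0.
by rewrite -yx => /esym; apply: c_proper; rewrite ?yx.
Qed.
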